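(* Given any collection of $24$ colored cubes (repetitions of varieties allowed, varieties arbitrary), there is always a subset of $8$ of them from which one can construct a corner solution. Consequently $\mathrm{fr}(2)=24$.
   Context: Fix a palette of six colors. A colored cube is a unit cube each of whose six faces is painted with a single color, every one of the six colors appearing on some face (so each color appears exactly once). Two colored cubes are of the same variety if one can be rigidly rotated onto the other with colors matching; there are exactly $30$ varieties. A solution of size $n$ is an arrangement of $n^3$ colored cubes into an $n\times n\times n$ cube such that each of its six outer faces is a single color. A corner solution is a set of eight colored cubes arranged as the $2\times 2\times 2$ cube (equivalently, as the eight corners of a solution) with each outer face a single color. The frame of an $n\times n\times n$ cube consists of the $12(n-2)+8=12n-16$ unit positions lying on its edges (corners included); building a frame means placing colored cubes into all these positions so that all visible faces on each of the six outer faces of the big cube have one common color for that face. $\mathrm{fr}(n)$ denotes the smallest number $N$ such that from any collection of $N$ colored cubes (of arbitrary varieties, with repetition) one can select cubes to build an $n\times n\times n$ frame. (For $n=2$ the frame is just a corner solution.) *)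

(* Defs.v *)
From mathcomp Require Import all_boot all_fingroup.

Set Implicit Arguments.
Unset Strict Implicit.
Unset Printing Implicit Defensive.

Definition color : finType := 'I_6.

(* (i, b) is the face orthogonal to axis i, with outer normal +e_i if b = true
   and -e_i if b = false. *)
Definition face : finType := ('I_3 * bool)%type.

Record colored_cube := ColoredCube {
  paint :> face -> color;
  paint_surj : forall k : color, exists x : face, paint x = k }.

(* (s, e) is the signed permutation e_i |-> (-1)^(e i) e_(s i), of determinant
   sgn(s) * (-1)^#|{i | e i}|; the rotations of the cube are those of
   determinant 1. *)
Record rotation := Rotation {
  rot_axis : 'S_3;
  rot_flip : 'I_3 -> bool;
  rot_det1 : odd_perm rot_axis = odd #|[set i | rot_flip i]| }.

Definition rotate (r : rotation) (x : face) : face :=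
  (rot_axis r x.1, x.2 (+) rot_flip r x.1).

Definition position (n : nat) : finType := {ffun 'I_3 -> 'I_n}.

Definition on_outer_face (n : nat) (p : position n) (x : face) : bool :=
  if x.2 then (p x.1).+1 == n else p x.1 == 0 :> nat.

Definition frame (n : nat) : {set position n} :=
  [set p | 1 < #|[set i : 'I_3 | on_outer_face p (i, false)
                                || on_outer_face p (i, true)]|].

(* The cubes with index in A, each used once, fill the positions of D.  The
   cube at p is turned by [turn p], so its face x ends up in direction
   [rotate (turn p) x]; [outer] gives the single color of each outer face of
   the big cube.  As for a colored cube, these six colors are all different. *)
Definition arrangement (n : nat) (D : {set position n}) (I : finType)
    (cubes : I -> colored_cube) (A : {set I}) : Prop :=
  exists (place : position n -> I) (turn : position n -> rotation)
         (outer : face -> color),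
    [/\ {in D &, injective place},
        place @: D = A,
        injective outer
      & forall (p : position n) (x : face), p \in D ->
          on_outer_face p (rotate (turn p) x) ->
          cubes (place p) x = outer (rotate (turn p) x)].

Definition corner_solution (I : finType) (cubes : I -> colored_cube)
    (A : {set I}) : Prop :=
  arrangement [set: position 2] cubes A.

Definition frame_always_buildable (n N : nat) : Prop :=
  forall cubes : 'I_N -> colored_cube,
    exists A : {set 'I_N}, arrangement (frame n) cubes A.

(* fr(n) = N *)
Definition is_fr (n N : nat) : Prop :=
  frame_always_buildable n N /\
  forall M : nat, frame_always_buildable n M -> N <= M.

(* Main.v *)
Require Import Defs.
From mathcomp Require Import all_boot all_fingroup.

(* Two varieties share either no corner or exactly two.  Fix a target variety
   v and view the eight corners of v as vertices and the cubes of the other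
   varieties sharing corners with v as edges.  A set of edges can be assigned
   to distinct endpoints covering every vertex iff no component is a tree, and
   a cube of variety v can fill any corner; hence v can be built iff its
   multiplicity is at least the number of tree components.  This number only
   depends on the multiplicities truncated at 2, and a branch and bound on
   these, modulo recolorings and reflection, shows that the multiplicities add
   up to at most 23 if no variety can be built.  The value 23 is reached by
   7, 7, 7, 1, 1 cubes of five varieties that share no corner pairwise. *)

Set Implicit Arguments.
Unset Strict Implicit.
Unset Printing Implicit Defensive.

(** Sequences stand for maps on indices. Composing a painting on the right with a rotation code
    turns the cube; composing it on the left with a permutation of colors recolors it. *)
Definition compose (s t : seq nat) : seq nat := [seq nth 0 s k | k <- t].

(** * Faces, rotations and corners as sequences of numbers *)

(** Opposite faces get the numbers 2i and 2i+1: halving gives the axis, parity the direction. *)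
Definition face_code (x : face) : nat := x.1.*2 + x.2.

Definition code_face (k : nat) : face := (inord k./2, odd k).

Definition paint_code (o : face -> color) : seq nat :=
  mkseq (fun k => o (code_face k) : nat) 6.

(** A corner is coded by the three outer faces that meet there, one for each axis. *)
Definition corner_code (p : position 2) : seq nat :=
  mkseq (fun i => i.*2 + p (inord i)) 3.

Definition rotation_code (r : rotation) : seq nat :=
  mkseq (fun k => face_code (rotate r (code_face k))) 6.

Definition bits : seq bool := [:: false; true].

Definition triples : seq (seq bool) :=
  [seq a :: s | a <- bits, s <- [seq [:: b; c] | b <- bits, c <- bits]].

Definition signed_code (s : seq nat) (e : seq bool) : seq nat :=
  mkseq (fun k => (nth 0 s k./2).*2 + (odd k (+) nth false e k./2)) 6.

(* A permutation s of {0, 1, 2} is even iff s 1 = s 0 + 1 modulo 3. *)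
Definition rotations : seq (seq nat) :=
  [seq signed_code x.1 x.2
     | x <- [seq (s, e) | s <- permutations (iota 0 3), e <- triples]
     & (nth 0 x.1 1 != (nth 0 x.1 0).+1 %% 3) == foldr addb false x.2].

Definition corners : seq (seq nat) :=
  [seq mkseq (fun i => i.*2 + nth false b i) 3 | b <- triples].

(** Boolean form of the placement condition at one corner [P], for a cube painted [q] and outer
    colors [o]. *)
Definition fits (q o P : seq nat) : bool :=
  has (fun r => all (fun f => (nth 0 r f \in P) ==>
                              (nth 0 q f == nth 0 o (nth 0 r f))) (iota 0 6))
      rotations.

Lemma face_code_lt x : face_code x < 6.
Proof. by case: x => -[[|[|[|i]]] lti] []. Qed.

Lemma face_codeK : cancel face_code code_face.
Proof.
case=> i b; rewrite /code_face /face_code /= addnC half_bit_double inord_val.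
by rewrite oddD odd_double addbF; case: b.
Qed.

Lemma code_faceK k : k < 6 -> face_code (code_face k) = k.
Proof.
by case: k => [|[|[|[|[|[|k]]]]]] // _; rewrite /face_code /code_face /= inordK.
Qed.

Lemma paint_codeE o x : nth 0 (paint_code o) (face_code x) = o x.
Proof. by rewrite nth_mkseq ?face_code_lt // face_codeK. Qed.

Lemma rotation_codeE r x :
  nth 0 (rotation_code r) (face_code x) = face_code (rotate r x).
Proof. by rewrite nth_mkseq ?face_code_lt // face_codeK. Qed.

Lemma ord3_cases (i : 'I_3) : [\/ i = inord 0, i = inord 1 | i = inord 2].
Proof.
by case: i => -[|[|[|//]]] lti; [constructor 1|constructor 2|constructor 3];
   apply: val_inj; rewrite /= inordK.
Qed.


Lemma on_outer_faceE (p : position 2) x :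
  on_outer_face p x = (face_code x \in corner_code p).
Proof.
have lt2 i : p i = 0 :> nat \/ p i = 1 :> nat by case: (p i) => -[|[|]]; [left|right|].
case: x => i b; rewrite /on_outer_face /corner_code /face_code !inE /=.
move: (lt2 (inord 0)) (lt2 (inord 1)) (lt2 (inord 2)).
case: (ord3_cases i) => -> [->|->] [->|->] [->|->]; rewrite inordK //; case: b => //.
Qed.

Lemma odd_perm3 (s : 'S_3) :
  odd_perm s = (s (inord 1) != (s (inord 0)).+1 %% 3 :> nat).
Proof.
pose i k : 'I_3 := inord k.
have iE k l : k < 3 -> l < 3 -> (i k == i l) = (k == l).
  by move=> lt_k lt_l; rewrite -val_eqE /= !inordK.
have odd_s k l k' l' : s =1 (tperm (i k) (i l) * tperm (i k') (i l'))%g ->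
    odd_perm s = (i k != i l) (+) (i k' != i l').
  by move/permP->; rewrite odd_permM !odd_tperm.
have s_inj k l : k < 3 -> l < 3 -> k != l -> s (i k) <> s (i l).
  by move=> lt_k lt_l nkl /perm_inj/eqP; rewrite iE // (negPf nkl).
move: (s_inj 0 1 isT isT isT) (s_inj 0 2 isT isT isT) (s_inj 1 2 isT isT isT).
case: (ord3_cases (s (i 0))) => s0; case: (ord3_cases (s (i 1))) => s1;
  case: (ord3_cases (s (i 2))) => s2; rewrite s0 s1 s2 // => _ _ _;
  rewrite !inordK //=;
  (* In order: the identity, (1 2), (0 1), the two 3-cycles and (0 2), each as a product of two
     [tperm], where 0 0 gives the identity. *)
  [ rewrite (odd_s 0 0 0 0) | rewrite (odd_s 1 2 0 0) | rewrite (odd_s 0 1 0 0)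
  | rewrite (odd_s 0 1 0 2) | rewrite (odd_s 0 2 0 1) | rewrite (odd_s 0 2 0 0)];
  rewrite ?iE // => j; case: (ord3_cases j) => ->;
  by rewrite permM !permE /= -/(i 0) -/(i 1) -/(i 2) ?(s0, s1, s2) !iE //= ?iE.
Qed.

Lemma card_pred3 (e : 'I_3 -> bool) :
  odd #|[set i | e i]| = foldr addb false (mkseq (fun i => e (inord i)) 3).
Proof.
have -> : #|[set i | e i]| = \sum_(i < 3) e (inord i).
  rewrite -sum1_card big_mkcond; apply: eq_bigr => i _.
  by rewrite inE inord_val; case: (e i).
by rewrite !big_ord_recr big_ord0 /=; do 3![case: (e _)].
Qed.

Lemma triplesP (b : seq bool) : size b = 3 -> b \in triples.
Proof. by case: b => [|[] [|[] [|[] [|]]]]. Qed.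

Lemma mem_permutations_iota n s :
  uniq s -> size s = n -> all (gtn n) s -> s \in permutations (iota 0 n).
Proof.
move=> us sz /allP lt_s; rewrite mem_permutations uniq_perm ?iota_uniq //.
have [||_ //] := uniq_min_size us (s2 := iota 0 n); last by rewrite size_iota sz.
by move=> k /lt_s; rewrite mem_iota.
Qed.

Lemma rotation_code_mem r : rotation_code r \in rotations.
Proof.
pose s := mkseq (fun i => rot_axis r (inord i) : nat) 3.
pose e := mkseq (fun i => rot_flip r (inord i)) 3.
have -> : rotation_code r = signed_code s e by [].
apply/mapP; exists (s, e) => //; rewrite mem_filter allpairs_f ?triplesP ?andbT //.
  by rewrite -[foldr _ _ _]card_pred3 -rot_det1 odd_perm3.
apply: mem_permutations_iota; rewrite ?size_mkseq //.
  apply/mkseq_uniqP=> k l lt_k lt_l /val_inj/perm_inj/(congr1 val).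
  by rewrite /= !inordK.
by apply/allP=> _ /mapP[k _ ->]; apply: ltn_ord.
Qed.

(** With [rotation_code_mem], this makes [rotations] exactly the rotation group, so that the
    existence of a turn becomes a finite test. *)
Lemma rotationsP l : l \in rotations -> exists r, l = rotation_code r.
Proof.
case/mapP=> -[s e]; rewrite mem_filter => /andP[/eqP par].
case/allpairsPdep=> s' [e' [+ + [eq_s eq_e]]]; rewrite -{}eq_s -{}eq_e {s' e'}.
rewrite mem_permutations => ps eT ->.
have szs : size s = 3 by rewrite (perm_size ps).
have lt_s i : i < 3 -> nth 0 s i < 3.
  move=> lt_i; have: nth 0 s i \in s by rewrite mem_nth ?szs.
  by rewrite (perm_mem ps) mem_iota.
pose f (i : 'I_3) : 'I_3 := inord (nth 0 s i).
have f_inj : injective f.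
  move=> i j /(congr1 val); rewrite /= !inordK ?lt_s // => /eqP.
  by rewrite nth_uniq ?szs // ?(perm_uniq ps) // => /eqP/val_inj.
have det : odd_perm (perm f_inj) = odd #|[set i : 'I_3 | nth false e i]|.
  rewrite odd_perm3 card_pred3 !permE /f !inordK ?lt_s ?inordK // par.
  have /eqP : size e == 3.
    by apply: (allP (_ : all (fun e => size e == 3) triples)) eT.
  by case: (e) => [|a [|b [|c []]]] //= _; rewrite !inordK.
exists (Rotation det); apply: (@eq_from_nth _ 0) => [|k]; rewrite ?size_mkseq // => lt_k.
have lt_k2 : k./2 < 3 by move: k lt_k; do 6![case=> //].
by rewrite /rotation_code /signed_code /face_code !nth_mkseq //= permE !inordK ?lt_s.
Qed.

Lemma fitsP (q o : face -> color) (p : position 2) :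
  reflect (exists r, forall x, on_outer_face p (rotate r x) ->
             q x = o (rotate r x))
          (fits (paint_code q) (paint_code o) (corner_code p)).
Proof.
apply: (iffP hasP) => [[_ /rotationsP[r ->] /allP fr]|[r fr]].
  exists r => x; rewrite on_outer_faceE -rotation_codeE => px.
  have := fr (face_code x); rewrite mem_iota face_code_lt => /(_ isT).
  by rewrite px rotation_codeE !paint_codeE => /eqP/val_inj.
exists (rotation_code r); first exact: rotation_code_mem.
apply/allP=> k; rewrite mem_iota => /andP[_ /code_faceK <-]; apply/implyP.
by rewrite rotation_codeE -on_outer_faceE !paint_codeE => /fr ->.
Qed.

Lemma paint_code_lt (o : face -> color) : all (gtn 6) (paint_code o).
Proof. by apply/allP=> _ /mapP[k _ ->]; apply: ltn_ord. Qed.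

Lemma inj_paint_code (o : face -> color) :
  injective o -> paint_code o \in permutations (iota 0 6).
Proof.
move=> o_inj; apply: mem_permutations_iota (paint_code_lt o); last exact: size_mkseq.
apply/mkseq_uniqP=> k l lt_k lt_l /val_inj/o_inj/(congr1 face_code).
by rewrite !code_faceK.
Qed.

Lemma cube_paint_code (c : colored_cube) :
  paint_code c \in permutations (iota 0 6).
Proof.
apply: mem_permutations_iota (paint_code_lt c); last exact: size_mkseq.
apply: (leq_size_uniq (iota_uniq 0 6)); last by rewrite size_mkseq.
move=> k; rewrite mem_iota => /andP[_ lt_k].
have [x cx] := paint_surj c (Ordinal lt_k).
have -> : k = c x by rewrite cx.
by rewrite -paint_codeE mem_nth // size_mkseq face_code_lt.
Qed.

(** Inverse of [paint_code] on permutations of 0, ..., 5: it turns computed sequences back into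
    outer colorings and cubes. *)
Definition decode (s : seq nat) (x : face) : color := inord (nth 0 s (face_code x)).

Section Decode.

Variable s : seq nat.
Hypothesis s_perm : s \in permutations (iota 0 6).

Let perm_s : perm_eq s (iota 0 6).
Proof. by rewrite -mem_permutations. Qed.

Let size_s : size s = 6. Proof. by rewrite (perm_size perm_s). Qed.

Let decodeE x : decode s x = nth 0 s (face_code x) :> nat.
Proof.
have: nth 0 s (face_code x) \in s by rewrite mem_nth ?size_s ?face_code_lt.
by rewrite (perm_mem perm_s) mem_iota => /andP[_ lt_s]; rewrite /= inordK.
Qed.

Lemma decodeK : paint_code (decode s) = s.
Proof.
apply: (@eq_from_nth _ 0); rewrite size_mkseq // => k lt_k.
by rewrite nth_mkseq // decodeE code_faceK.
Qed.

Lemma decode_inj : injective (decode s).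
Proof.
move=> x y /(congr1 val); rewrite /= !decodeE => /eqP.
rewrite nth_uniq ?size_s ?face_code_lt ?(perm_uniq perm_s) ?iota_uniq //.
by move/eqP/(can_inj face_codeK).
Qed.

Lemma decode_surj (k : color) : exists x, decode s x = k.
Proof.
have ks : val k \in s by rewrite (perm_mem perm_s) mem_iota ltn_ord.
have lt_k : index (val k) s < 6 by rewrite -[X in _ < X]size_s index_mem.
exists (code_face (index (val k) s)); apply: val_inj.
by rewrite /= decodeE code_faceK ?nth_index.
Qed.

End Decode.

Lemma corner_code_mem p : corner_code p \in corners.
Proof.
apply/mapP; exists (mkseq (fun i => p (inord i) == 1 :> nat) 3).
  exact: triplesP.
apply/eq_in_map=> i; rewrite mem_iota => lt_i; rewrite nth_mkseq //.
by congr (_ + _); case: (p _) => -[|[|]].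
Qed.

Lemma cornersP P : P \in corners -> exists p, P = corner_code p.
Proof.
case/mapP=> b _ ->; exists [ffun i : 'I_3 => inord (nth false b i) : 'I_2].
apply/eq_in_map=> i; rewrite mem_iota => /andP[_ lt_i].
by rewrite ffunE (inordK lt_i) inordK //; case: (nth _ _ _).
Qed.

Lemma corner_code_inj : injective corner_code.
Proof.
move=> p p' eq_p; apply/ffunP=> i; apply: val_inj.
have := congr1 (fun s => nth 0 s i) eq_p.
by rewrite /corner_code !nth_mkseq // !inord_val => /addnI.
Qed.

(** * The thirty varieties and their corners *)

(** Normal forms under rotation: color 0 on face 0, and on face 2 the smallest of the four lateral
    colors. This leaves 5 * 3! = 30 paintings. *)
Definition varieties : seq (seq nat) := Eval vm_compute in
  [seq q <- permutations (iota 0 6)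
     | (nth 0 q 0 == 0) && all (ltn (nth 0 q 2)) (drop 3 q)].

Definition variety (q : seq nat) : nat :=
  find (fun v => has (fun r => compose v r == q) rotations) varieties.

(* A corner is represented by the list of the six varieties that have it;
   [nth [::] slots v] lists the eight corners of [v]. *)
Definition slots : seq (seq (seq nat)) := Eval vm_compute in
  [seq [seq [seq w <- iota 0 30 | fits (nth [::] varieties w) v P]
          | P <- corners] | v <- varieties].

(* Two varieties have either no common corner or exactly two. *)
Definition adjacency : seq (seq (seq (nat * nat))) := Eval vm_compute in
  [seq [seq if [seq k <- iota 0 8 | w \in nth [::] (nth [::] slots v) k]
              is [:: k; l] then [:: (k, l)] else [::] | v <- iota 0 30]
     | w <- iota 0 30].

Lemma rotations_wf :
  all (fun r => (size r == 6) && all (gtn 6) r) rotations.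
Proof. by vm_compute. Qed.

Lemma rotations_compose :
  all (fun r => all (fun r' => compose r r' \in rotations) rotations) rotations.
Proof. by vm_compute. Qed.

Lemma variety_total :
  all (fun q => variety q < 30) (permutations (iota 0 6)).
Proof. by vm_compute. Qed.

Lemma varieties_perm :
  all (mem (permutations (iota 0 6))) varieties.
Proof. by vm_compute. Qed.

Lemma slots_wf : (size slots == 30) &&
  all (fun v => let s := nth [::] slots v in
         [&& size s == 8, uniq s & all (fun c => v \in c) s]) (iota 0 30).
Proof. by vm_compute. Qed.

Lemma slots_fits_check :
  all (fun v => all (fun k => all (fun w =>
         fits (nth [::] varieties w) (nth [::] varieties v) (nth [::] corners k))
       (nth [::] (nth [::] slots v) k)) (iota 0 8)) (iota 0 30).
Proof. by vm_compute. Qed.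

Lemma adjacency_check :
  all (fun w => let a := nth [::] adjacency w in (size a == 30) &&
    all (fun v => all (fun x =>
      [&& w != v, w \in nth [::] (nth [::] slots v) x.1
        & w \in nth [::] (nth [::] slots v) x.2]) (nth [::] a v)) (iota 0 30))
  (iota 0 30).
Proof. by vm_compute. Qed.

Lemma size_slots v : v < 30 -> size (nth [::] slots v) = 8.
Proof.
case/andP: slots_wf => _ /allP wf lt_v; move: (wf v); rewrite mem_iota lt_v.
by case/(_ isT)/and3P=> /eqP.
Qed.

Lemma slots_uniq v : v < 30 -> uniq (nth [::] slots v).
Proof.
case/andP: slots_wf => _ /allP wf lt_v; move: (wf v); rewrite mem_iota lt_v.
by case/(_ isT)/and3P.
Qed.

Lemma slots_self v c : c \in nth [::] slots v -> v \in c.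
Proof.
case/andP: slots_wf => /eqP sz /allP wf; have [lt_v | le_v] := ltnP v 30.
  move: (wf v); rewrite mem_iota lt_v => /(_ isT)/and3P[_ _ /allP]; exact.
by rewrite nth_default ?sz.
Qed.

Lemma adjacencyP w v : w < 30 -> v < 30 ->
  {in nth [::] (nth [::] adjacency w) v, forall x,
    [/\ w != v, w \in nth [::] (nth [::] slots v) x.1
      & w \in nth [::] (nth [::] slots v) x.2]}.
Proof.
move=> lt_w lt_v x ax; move/allP: adjacency_check => /(_ w).
rewrite mem_iota lt_w => /(_ isT)/andP[_ /allP/(_ v)].
by rewrite mem_iota lt_v => /(_ isT)/allP/(_ x ax)/and3P.
Qed.

Lemma size_adjacency w : w < 30 -> size (nth [::] adjacency w) = 30.
Proof.
move=> lt_w; move/allP: adjacency_check => /(_ w).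
by rewrite mem_iota lt_w => /(_ isT)/andP[/eqP].
Qed.

(** A turn of the cube is absorbed into the rotation that places it, so whether a cube fits depends
    only on its variety. *)
Lemma fits_compose q r o P :
  r \in rotations -> fits q o P -> fits (compose q r) o P.
Proof.
move=> rR /hasP[r' r'R /allP fr]; apply/hasP; exists (compose r' r).
  by move/allP: rotations_compose => /(_ r' r'R)/allP; apply.
have /andP[/eqP sz /allP lt_r] := allP rotations_wf r rR.
apply/allP=> f; rewrite mem_iota => /andP[_ lt_f].
rewrite !(nth_map 0) ?sz //; apply: fr.
by rewrite mem_iota; apply: lt_r; rewrite mem_nth ?sz.
Qed.

Lemma cube_fits (c : colored_cube) v k :
    v < 30 -> k < 8 ->
    variety (paint_code c) \in nth [::] (nth [::] slots v) k ->
  fits (paint_code c) (nth [::] varieties v) (nth [::] corners k).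
Proof.
move=> lt_v lt_k cv; set w := variety _ in cv.
have lt_w : w < 30 := allP variety_total _ (cube_paint_code c).
have /hasP[r rR /eqP <-] :
    has (fun r => compose (nth [::] varieties w) r == paint_code c) rotations.
  pose a v := has (fun r => compose v r == paint_code c) rotations.
  by apply: (@nth_find _ [::] a); rewrite has_find.
apply: fits_compose rR _; move/allP: slots_fits_check => /(_ v).
rewrite mem_iota lt_v => /(_ isT)/allP/(_ k).
by rewrite mem_iota lt_k => /(_ isT)/allP; apply.
Qed.

(** * Filling the corners of a variety *)

(** Each pair in [L] is one cube, given by its variety, together with the corner that it fills; [m]
    counts the cubes available in each variety. *)
Definition covers (m : nat -> nat) (C : seq (seq nat)) : Prop :=
  exists L : seq (nat * seq nat),
    [/\ all (fun x => (x.1 < 30) && (x.1 \in x.2)) L,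
        {subset C <= unzip2 L}
      & forall w, w < 30 -> count_mem w (unzip1 L) <= m w].

Definition solvable (m : nat -> nat) (v : nat) : Prop :=
  covers m (nth [::] slots v).

Lemma covers_sub m m' C C' :
    {in gtn 30, forall w, m w <= m' w} -> {subset C' <= C} ->
  covers m C -> covers m' C'.
Proof.
move=> le_m sC [L [incL subL cntL]]; exists L; split=> // [c /sC /subL //|w lt_w].
exact: leq_trans (cntL w lt_w) (le_m w lt_w).
Qed.

Definition slots_in (v : nat) (U : pred nat) : seq (seq nat) :=
  [seq nth [::] (nth [::] slots v) k | k <- iota 0 8 & U k].

(* [B] plays the role of the tree components of the graph on the corners of
   [v] whose edges are the chosen cubes: a set of corners containing none of
   them can be filled without using [v] itself. *)
Definition forest (v : nat) (m : nat -> nat) (B : seq (seq nat)) : Prop :=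
  [::] \notin B /\
  forall U : pred nat, all (has (predC U)) B ->
    covers (fun w => if w == v then 0 else m w) (slots_in v U).

Lemma forest_le v m m' B :
  {in gtn 30, forall w, m w <= m' w} -> forest v m B -> forest v m' B.
Proof.
move=> le_m [nB covB]; split=> // U /covB; apply: covers_sub => // w lt_w.
by case: ifP => // _; apply: le_m.
Qed.

(** Without edges, the eight corners are eight trees with one vertex each. *)
Lemma forest_start v : forest v (fun=> 0) [seq [:: k] | k <- iota 0 8].
Proof.
split=> // U U0; exists [::]; split=> // c /mapP[k].
rewrite mem_filter => /andP[Uk k8] _; move: (allP U0 [:: k]).
by rewrite map_f // /= Uk => /(_ isT).
Qed.

(** Nested [if] and [eqn] let the evaluation of the search stop at the first hit. *)
Fixpoint touches (k l : nat) (A : seq nat) : bool :=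
  if A is j :: A' then
    if eqn j k then true else if eqn j l then true else touches k l A'
  else false.

Lemma touchesE k l A : touches k l A = (k \in A) || (l \in A).
Proof.
elim: A => //= j A ->; rewrite !inE !eqnE (eq_sym j k) (eq_sym j l).
by case: eqP; case: eqP; rewrite ?orbT.
Qed.

Fixpoint separate (k l : nat) (B : seq (seq nat)) :
    seq (seq nat) * seq (seq nat) :=
  if B is A :: B' then
    let: (T, R) := separate k l B' in
    if touches k l A then (A :: T, R) else (T, A :: R)
  else ([::], [::]).

Lemma separateE k l B :
  separate k l B = (filter (touches k l) B, filter (predC (touches k l)) B).
Proof. by elim: B => //= A B ->; case: (touches k l A). Qed.

(* An edge inside a tree component, or joining it to a component with a
   cycle, removes it; an edge between two tree components merges them. *)
Definition absorb (e : seq (nat * nat)) (B : seq (seq nat)) : seq (seq nat) :=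
  if e is [:: (k, l)] then
    match separate k l B with
    | ([:: _], R) => R
    | ([:: A; A'], R) => (A ++ A') :: R
    | _ => B
    end
  else B.

Lemma covers_add v m w k U :
    w < 30 -> w != v -> w \in nth [::] (nth [::] slots v) k ->
    covers (fun u => if u == v then 0 else m u) (slots_in v [predD1 U & k]) ->
  covers (fun u => if u == v then 0 else m u + (u == w)) (slots_in v U).
Proof.
move=> lt_w nwv wk [L [incL subL cntL]].
exists ((w, nth [::] (nth [::] slots v) k) :: L); split=> [|c|u lt_u] /=.
- by rewrite lt_w wk.
- case/mapP=> j; rewrite mem_filter => /andP[Uj j8] ->; rewrite inE.
  have [-> | njk] := eqVneq j k; first by rewrite eqxx.
  by rewrite subL ?orbT // map_f // mem_filter /= njk j8; apply/andP.
- move: (cntL u lt_u); rewrite (eq_sym w u); have [-> | _] := eqVneq u v.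
    by rewrite (eq_sym v w) (negPf nwv).
  by rewrite addnC leq_add2r.
Qed.

(** The new cube fills one endpoint of its edge, and the old property fills the rest. If one tree is
    touched, that endpoint is the corner this tree had to leave out, so the tree no longer
    constrains [U]. *)
Lemma forest_absorb (v : nat) m (w : nat) (e : seq (nat * nat)) B :
    w < 30 -> w != v ->
    {in e, forall x, (w \in nth [::] (nth [::] slots v) x.1) &&
                     (w \in nth [::] (nth [::] slots v) x.2)} ->
  forest v m B -> forest v (fun u => m u + (u == w)) (absorb e B).
Proof.
move=> lt_w nwv; pose m' u := m u + (u == w); rewrite -[fun u => m u + _]/m'.
have le_m : {in gtn 30, forall u, m u <= m' u} by move=> u _; apply: leq_addr.
case: e => [|[k l] [|x e]] /= inc fB; try exact: forest_le fB.
have{inc} /andP[/= wk wl] := inc _ (mem_head _ _).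
rewrite separateE; set T := filter _ B; set R := filter _ B.
have memB A : A \in B -> A \in T \/ A \in R.
  by rewrite !mem_filter => -> /=; case: (touches k l A); [left | right].
have [nB covB] := fB.
have nR : [::] \notin R by rewrite mem_filter (negPf nB) andbF.
have TB A : A \in T -> touches k l A /\ A \in B.
  by rewrite mem_filter => /andP.
(* Drop from U an endpoint of the new edge lying in A and give it that edge. *)
have step A U : touches k l A -> all (has (predC U)) R ->
    (forall A', A' \in T -> A' = A \/ has (predC U) A') ->
  covers (fun u => if u == v then 0 else m' u) (slots_in v U).
  rewrite touchesE => tA UR UT.
  have [j jA wj] : exists2 j, j \in A & w \in nth [::] (nth [::] slots v) j.
    by case/orP: tA => ?; [exists k | exists l].
  apply: (covers_add lt_w nwv wj); apply: covB; apply/allP=> A' /memB.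
  have wU : has (predC U) A' -> has (predC [predD1 U & j]) A'.
    by apply: sub_has => i /=; rewrite negb_and orbC => ->.
  case=> [/UT [-> | /wU //]|/(allP UR) /wU //].
  by apply/hasP; exists j => //=; rewrite eqxx.
case defT: T => [|A [|A' [|A'' T']]]; try exact: forest_le fB.
  have [tA AB] : touches k l A /\ A \in B by apply: TB; rewrite defT mem_head.
  split=> // U UR; apply: (step A) => // A'; rewrite defT inE => /eqP->; by left.
have [tA AB] : touches k l A /\ A \in B by apply: TB; rewrite defT mem_head.
have [tA' A'B] : touches k l A' /\ A' \in B.
  by apply: TB; rewrite defT !inE eqxx orbT.
split=> [|U /= /andP[]].
  by rewrite inE (negPf nR) orbF; case: A tA {AB defT}.
(* A corner outside [U] lies in one half of the merged tree; the new edge then serves the other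
   half. *)
rewrite has_cat => /orP[] UA UR; [apply: (step A') | apply: (step A)] => //.
  by move=> A1; rewrite defT !inE => /orP[]/eqP->; [right | left].
by move=> A1; rewrite defT !inE => /orP[]/eqP->; [left | right].
Qed.

(** A cube of variety [v] has every corner of [v]. Putting one at the first corner of each tree
    leaves a set that the other varieties fill. *)
Lemma forest_solvable v m B :
  v < 30 -> forest v m B -> size B <= m v -> solvable m v.
Proof.
move=> lt_v [nB covB] leB.
pose X := [seq head 0 A | A <- B].
have [|L [incL subL cntL]] := covB (predC (mem X)).
  apply/allP=> A AB; apply/hasP; exists (head 0 A); last by rewrite /= negbK map_f.
  by case: A AB nB => [->|j A] //= _ _; apply: mem_head.
(* Nothing bounds the entries of [B], so those that are not corner numbers are dropped. *)
pose L' := [seq (v, nth [::] (nth [::] slots v) k) | k <- X & k < 8].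
exists (L' ++ L); split=> [|c|w lt_w].
- rewrite all_cat incL andbT; apply/allP=> _ /mapP[k + ->] /=.
  rewrite mem_filter lt_v => /andP[lt_k _]; apply: slots_self.
  by rewrite mem_nth // size_slots.
- case/(nthP [::])=> k; rewrite size_slots // => lt_k <-.
  rewrite /unzip2 map_cat mem_cat; case kX: (k \in X).
    by rewrite -map_comp map_f // mem_filter lt_k.
  by rewrite subL ?orbT // map_f // mem_filter mem_iota /= kX.
rewrite /unzip1 map_cat count_cat -map_comp; move: (cntL w lt_w).
have [-> | nwv] := eqVneq w v.
  rewrite ?eqxx leqn0 => /eqP->; rewrite addn0; apply: leq_trans leB.
  apply: leq_trans (count_size _ _) _; rewrite size_map size_filter.
  by apply: leq_trans (count_size _ _) _; rewrite size_map.
by move=> cntw; rewrite (count_memPn _) //; apply/mapP=> -[k _ /= /eqP]; apply/negP.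
Qed.

(** * Branch and bound *)

(* [low] bounds the multiplicity of a variety from below; unless the cell is
   [free], the multiplicity is known to be [low]. *)
Record cell := Cell { low : nat; free : bool; blocks : seq (seq nat) }.
Definition cell0 : cell := Cell 0 true [::].

Definition raise (w : nat) (st : seq cell) : seq cell :=
  let st' := [seq Cell (low x.1) (free x.1) (absorb x.2 (blocks x.1))
                | x <- zip st (nth [::] adjacency w)] in
  let c := nth cell0 st' w in
  set_nth cell0 st' w (Cell (low c).+1 (free c) (blocks c)).

Definition freeze (w : nat) (st : seq cell) : seq cell :=
  let c := nth cell0 st w in
  set_nth cell0 st w (Cell (low c) false (blocks c)).

(** Packs [low] and [free], the data that [within] speaks of, into one number per variety. *)
Definition fixes (st : seq cell) (g : seq nat) : bool :=
  let key := [seq (free c + (low c).*2) | c <- st] in compose key g == key.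

Definition solved (c : cell) : bool := size (blocks c) <= low c.

(** An upper bound for the multiplicity of a variety that cannot be built: it must stay below the
    number of trees. *)
Definition ceiling (c : cell) : nat :=
  if free c then (size (blocks c)).-1 else low c.

(* Two parallel edges already close a cycle, so bounds above 2 are useless. *)
Definition gap (c : cell) : nat := if low c < 2 then ceiling c - low c else 0.

(* Either some variety in the orbit of w under G occurs more often than its
   lower bound, and then w does without loss of generality, or the whole orbit
   is frozen. *)
Fixpoint search (n : nat) (G : seq (seq nat)) (st : seq cell) : bool :=
  if n is n'.+1 then
    if has solved st then true else
    if sumn [seq ceiling c | c <- st] < 24 then true else
    let gaps := map gap st in
    let w := index (foldr maxn 0 gaps) gaps in
    let st1 := raise w st in
    if search n' (filter (fixes st1) G) st1 then
      let st2 := foldr freeze st (w :: [seq nth 0 g w | g <- G]) in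
      search n' (filter (fixes st2) G) st2
    else false
  else false.

Definition lower (st : seq cell) (v : nat) : nat := low (nth cell0 st v).

Definition sound (st : seq cell) : Prop :=
  size st = 30 /\
  forall v, v < 30 -> forest v (lower st) (blocks (nth cell0 st v)).

Definition within (st : seq cell) (m : nat -> nat) : Prop :=
  forall v, v < 30 ->
    lower st v <= m v /\ (free (nth cell0 st v) \/ m v = lower st v).

(** The buildable variety may change under [g]; it is enough that one exists. This justifies
    replacing [m] by its composite with [g] in the search. *)
Definition symmetry (g : seq nat) : Prop :=
  perm_eq g (iota 0 30) /\
  forall m v, v < 30 -> solvable (fun w => m (nth 0 g w)) v ->
    exists2 v', v' < 30 & solvable m v'.

Lemma symmetry_lt g w : symmetry g -> w < 30 -> nth 0 g w < 30.
Proof.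
case=> pg _ lt_w; have: nth 0 g w \in g by rewrite mem_nth // (perm_size pg).
by rewrite (perm_mem pg) mem_iota.
Qed.

Lemma raise_nth w st v : w < 30 -> size st = 30 -> v < 30 ->
  let c := nth cell0 st v in
  nth cell0 (raise w st) v =
    Cell (low c + (v == w)) (free c)
         (absorb (nth [::] (nth [::] adjacency w) v) (blocks c)).
Proof.
move=> lt_w sz lt_v; have szz := size_adjacency lt_w.
have nthz u : u < 30 -> nth (cell0, [::]) (zip st (nth [::] adjacency w)) u =
                        (nth cell0 st u, nth [::] (nth [::] adjacency w) u).
  by move=> lt_u; rewrite nth_zip // sz szz.
have szip : size (zip st (nth [::] adjacency w)) = 30 by rewrite size_zip sz szz.
rewrite /raise nth_set_nth /= !(nth_map (cell0, [::])) ?szip // !nthz //=.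
by case: eqP => [->|_]; rewrite ?addn1 ?addn0.
Qed.

Lemma size_raise w st : w < 30 -> size st = 30 -> size (raise w st) = 30.
Proof.
move=> lt_w sz; rewrite size_set_nth size_map size_zip sz size_adjacency //.
exact/maxn_idPr.
Qed.

Lemma raise_sound w st : w < 30 -> sound st -> sound (raise w st).
Proof.
move=> lt_w [sz fst]; split=> [|v lt_v]; first exact: size_raise.
have le_m : {in gtn 30, forall u,
    lower st u + (u == w) <= lower (raise w st) u}.
  by move=> u lt_u; rewrite /lower raise_nth.
rewrite raise_nth //=; apply: forest_le le_m _.
have [<- | nwv] := eqVneq w v.
  have -> : nth [::] (nth [::] adjacency w) w = [::].
    case: (nth [::] (nth [::] adjacency w) w) (@adjacencyP w w) => // x e.
    by case/(_ lt_w lt_w x (mem_head _ _)); rewrite eqxx.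
  by apply: forest_le (fst _ lt_w) => u _; apply: leq_addr.
apply: forest_absorb (fst v lt_v) => // x /(adjacencyP lt_w lt_v)[_].
by move=> -> ->.
Qed.

Lemma freeze_nth w st v : 
  let c := nth cell0 st v in
  nth cell0 (freeze w st) v = Cell (low c) (free c && (v != w)) (blocks c).
Proof.
rewrite /= nth_set_nth /=; case: eqP => [->|_]; first by rewrite andbF.
by rewrite andbT; case: (nth _ _ _).
Qed.

Lemma freezes_nth s st v : 
  let c := nth cell0 st v in
  nth cell0 (foldr freeze st s) v = Cell (low c) (free c && (v \notin s)) (blocks c).
Proof.
elim: s => /= [|w s IHs]; first by rewrite andbT; case: (nth _ _ _).
by rewrite freeze_nth IHs /= inE negb_or andbAC andbA.
Qed.

Lemma freezes_sound s st : all (gtn 30) s -> sound st -> sound (foldr freeze st s).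
Proof.
move=> s30 [sz fst]; split=> [|v lt_v].
  elim: s s30 => //= w s IHs /andP[lt_w /IHs szs].
  by rewrite size_set_nth szs; apply/maxn_idPr.
rewrite freezes_nth /=; apply: forest_le (fst v lt_v) => u _.
by rewrite /lower freezes_nth.
Qed.

Lemma fixes_nth st g v : fixes st g -> size st = 30 -> symmetry g -> v < 30 ->
  lower st (nth 0 g v) = lower st v /\
  free (nth cell0 st (nth 0 g v)) = free (nth cell0 st v).
Proof.
move=> /eqP/(congr1 (fun s => nth 0 s v)) + sz sg lt_v.
have lt_gv := symmetry_lt sg lt_v; have [pg _] := sg.
rewrite (nth_map 0) ?(perm_size pg) ?size_iota // !(nth_map cell0) ?sz // => eq_key.
split.
  by rewrite /lower -[LHS](@half_bit_double _ (free (nth cell0 st (nth 0 g v)))) 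
             eq_key half_bit_double.
have := congr1 odd eq_key.
by rewrite !oddD !odd_double !addbF; do 2![case: (free _)].
Qed.

Lemma foldr_maxn_mem s : 0 < size s -> foldr maxn 0 s \in s.
Proof.
elim: s => //= x [_ _|y s /(_ isT) IHs _]; first by rewrite maxn0 mem_head.
by rewrite inE /maxn; case: ifP; rewrite ?eqxx ?IHs ?orbT.
Qed.

Lemma within_raise w st m : w < 30 -> size st = 30 ->
  within st m -> lower st w < m w -> within (raise w st) m.
Proof.
move=> lt_w sz mst ltm v lt_v; rewrite /lower raise_nth //=.
have [lem dec] := mst v lt_v; have [eq_v | _] := eqVneq v w; last by rewrite addn0.
rewrite addn1; move: ltm dec; rewrite -eq_v => ltm [fv | eqm]; first by split=> //; left.
by rewrite -eqm ltnn in ltm.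
Qed.

Lemma search_solvable n G st m :
    search n G st -> sound st -> {in G, forall g, symmetry g /\ fixes st g} ->
    within st m -> 24 <= \sum_(0 <= v < 30) m v ->
  exists2 v, v < 30 & solvable m v.
Proof.
elim: n G st m => //= n IHn G st m + sst sG mst le24; have [sz fst] := sst.
have solve v : v < 30 -> size (blocks (nth cell0 st v)) <= m v ->
    exists2 v, v < 30 & solvable m v.
  move=> lt_v leB; exists v => //; apply: forest_solvable leB => //.
  by apply: forest_le (fst v lt_v) => u lt_u; case: (mst u lt_u).
case: ifP => [/(has_nthP cell0)[v] | _].
  rewrite sz => lt_v; rewrite /solved => leB _.
  by apply: (solve v lt_v) (leq_trans leB _); case: (mst v lt_v).
case: ifP => [lt24 _ | _].
  (* The total is at least 24, so some [m v] exceeds its ceiling; such a [v] is free and has a cube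
     for each of its trees. *)
  have [v lt_v ltm] : exists2 v, v < 30 & ceiling (nth cell0 st v) < m v.
    have [/hasP[v]|/hasPn lem] :=
        boolP (has (fun v => ceiling (nth cell0 st v) < m v) (iota 0 30)).
      by rewrite mem_iota => /andP[_ lt_v] ltm; exists v.
    suff: \sum_(0 <= v < 30) m v < 24 by rewrite ltnNge le24.
    apply: leq_ltn_trans lt24.
    rewrite sumnE big_map (big_nth cell0) sz big_nat [X in _ <= X]big_nat.
    by apply: leq_sum => v lt_v; rewrite leqNgt lem // mem_iota.
  move: ltm; rewrite /ceiling; case: ifP => [_ ltB | nf].
    by apply: (solve v lt_v); apply: leq_trans (leqSpred _) ltB.
  by case: (mst v lt_v) => _; rewrite nf => -[] // ->; rewrite ltnn.
have: index (foldr maxn 0 (map gap st)) (map gap st) < 30.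
  by rewrite -[X in _ < X]sz -(size_map gap) index_mem foldr_maxn_mem // size_map sz.
move: (index _ _) => w lt_w; case: ifP => // src1 src2.
have up m' : within st m' -> lower st w < m' w ->
    24 <= \sum_(0 <= v < 30) m' v -> exists2 v, v < 30 & solvable m' v.
  move=> mst' ltm; apply: IHn src1 _ _ _; first exact: raise_sound.
    by move=> g; rewrite mem_filter => /andP[-> /sG[]].
  exact: within_raise.
pose s := w :: [seq nth 0 g w | g <- G].
have {}src2 : search n (filter (fixes (foldr freeze st s)) G) (foldr freeze st s).
  exact: src2.
have lt_s : all (gtn 30) s.
  by rewrite /= lt_w; apply/allP=> _ /mapP[g /sG[sg _] ->]; apply: symmetry_lt.
have [|/hasPn ge_s] := boolP (has (fun u => lower st u < m u) s).
  case/hasP=> u; rewrite inE => /predU1P[-> | /mapP[g gG ->]] ltm; first exact: up.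
  have [sg fg] := sG g gG; have [pg solg] := sg.
  (* Relabelling by [g] moves the excess from [g w] to [w] and preserves both the state's
     constraints and the total. *)
  have [||| v lt_v] := up (fun v => m (nth 0 g v)); last exact: solg.
  - move=> v lt_v; have [<- <-] := fixes_nth fg sz sg lt_v.
    by apply: mst; apply: symmetry_lt.
  - by have [<- _] := fixes_nth fg sz sg lt_w.
  have := perm_size pg; rewrite size_iota => szg.
  rewrite -[X in \sum_(0 <= v < X) _]szg -(big_nth 0 predT m) (perm_big _ pg) /=.
  by rewrite -/(index_iota 0 30).
apply: IHn src2 _ _ _ le24; first exact: freezes_sound.
  by move=> g; rewrite mem_filter => /andP[-> /sG[]].
move=> v lt_v; rewrite /lower freezes_nth /=; have [lem dec] := mst v lt_v; split=> //.
have [vs | _] := boolP (v \in s); last by rewrite andbT.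
by right; apply/eqP; rewrite eqn_leq lem leqNgt ge_s.
Qed.

(** * Initial state and symmetries of the search *)

Definition start : seq cell :=
  nseq 30 (Cell 0 true [seq [:: k] | k <- iota 0 8]).

Lemma start_sound : sound start.
Proof.
split=> [|v lt_v]; first by rewrite size_nseq.
by rewrite nth_nseq lt_v; apply: forest_le (forest_start v).
Qed.

(** Corners are increasing lists of varieties; sorting makes the image comparable with the entries
    of [slots]. *)
Definition image (g c : seq nat) : seq nat := sort leq (compose g c).

Definition automorphism (g : seq nat) : bool :=
  perm_eq g (iota 0 30) &&
  all (fun v => all (fun c => c \in map (image g) (nth [::] slots v))
                    (nth [::] slots (nth 0 g v))) (iota 0 30).

(** Applying [g] to the varieties and corners of an assignment for [v] gives one for the variety
    [g v]. *)
Lemma automorphism_symmetry g : automorphism g -> symmetry g.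
Proof.
case/andP=> pg /allP autg; split=> // m v lt_v [L [incL subL cntL]].
have szg : size g = 30 by rewrite (perm_size pg) size_iota.
have ug : uniq g by rewrite (perm_uniq pg) iota_uniq.
have lt_g w : w < 30 -> nth 0 g w < 30.
  move=> lt_w; have: nth 0 g w \in g by rewrite mem_nth ?szg.
  by rewrite (perm_mem pg) mem_iota.
exists (nth 0 g v); first exact: lt_g.
exists [seq (nth 0 g x.1, image g x.2) | x <- L]; split.
- apply/allP=> _ /mapP[x /(allP incL)/andP[lt_x xx] ->] /=.
  by rewrite lt_g // mem_sort map_f.
- move=> c cv; have := autg v; rewrite mem_iota lt_v => /(_ isT)/allP/(_ c cv).
  case/mapP=> c' /subL /mapP[x xL ->] ->; rewrite /unzip2 -map_comp.
  by apply/mapP; exists x.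
move=> w lt_w; have wg : w \in g by rewrite (perm_mem pg) mem_iota.
have lt_i : index w g < 30 by rewrite -szg index_mem.
have := cntL _ lt_i; rewrite nth_index //; apply: leq_trans.
rewrite /unzip1 -map_comp !count_map; apply/eq_leq/eq_in_count=> x xL /=.
have /andP[lt_x _] := allP incL x xL.
by apply/eqP/eqP=> [<- | ->]; rewrite ?index_uniq ?nth_index ?szg.
Qed.

Lemma symmetry_compose g h : symmetry g -> symmetry h -> symmetry (compose g h).
Proof.
move=> sg sh; have [pg solg] := sg; have [ph solh] := sh; split.
  have szg : size g = 30 by rewrite (perm_size pg) size_iota.
  apply: perm_trans pg; rewrite -[X in perm_eq _ X](mkseq_nth 0) szg.
  by rewrite /mkseq perm_map.
move=> m v lt_v sol; have szh : size h = 30 by rewrite (perm_size ph) size_iota.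
have [u lt_u] : exists2 u, u < 30 & solvable (fun w => m (nth 0 g w)) u.
  apply: solh lt_v _; apply: covers_sub sol => // w lt_w.
  by rewrite (nth_map 0) ?szh.
exact: solg.
Qed.

Lemma symmetry_id : symmetry (iota 0 30).
Proof.
split=> // m v lt_v sol; exists v => //.
by apply: covers_sub sol => // w lt_w; rewrite nth_iota.
Qed.

Definition powers (g : seq nat) (k : nat) : seq (seq nat) :=
  [seq iter j (compose g) (iota 0 30) | j <- iota 0 k].

(* Every permutation of [0, n) is a unique product of powers of the cycles
   (0 1 .. k), k < n. *)
Definition products (gs : seq (seq nat * nat)) : seq (seq nat) :=
  foldr (fun x G => [seq compose a b | a <- powers x.1 x.2, b <- G])
        [:: iota 0 30] gs.

Lemma products_symmetry gs :
  all (fun x => automorphism x.1) gs -> {in products gs, forall g, symmetry g}.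
Proof.
elim: gs => [_ g|[a k] gs IHgs /= /andP[/automorphism_symmetry sa /IHgs sgs] g].
  by rewrite inE => /eqP->; apply: symmetry_id.
case/allpairsP=> -[b c] /= [/mapP[j _ ->] /sgs sc ->].
apply: symmetry_compose sc; elim: j => [|j]; first exact: symmetry_id.
exact: symmetry_compose.
Qed.

Definition recolor (s : seq nat) : seq nat :=
  [seq variety (compose s v) | v <- varieties].

(** Reflection along axis 0, which swaps faces 0 and 1. *)
Definition mirror : seq nat :=
  [seq variety (compose v [:: 1; 0; 2; 3; 4; 5]) | v <- varieties].

(** The reflection and the color cycles (0 1 .. k), each with its order, giving 2 * 6! products. *)
Definition generators : seq (seq nat * nat) := Eval vm_compute in
  (mirror, 2) ::
  [seq (recolor (rcons (iota 1 k) 0 ++ iota k.+1 (5 - k)), k.+1) | k <- iota 1 5].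

Lemma generators_automorphism : all (fun x => automorphism x.1) generators.
Proof. by vm_compute. Qed.

(** The fuel 100 bounds the depth; running out would give [false]. The identity is left out since
    [search] adds [w] to its orbit itself. The cast defers the evaluation to [Qed]. *)
Lemma search_start :
  search 100 [seq g <- products generators | g != iota 0 30] start.
Proof. by vm_cast_no_check (erefl true). Qed.

Lemma solvable24 m : 24 <= \sum_(0 <= v < 30) m v ->
  exists2 v, v < 30 & solvable m v.
Proof.
apply: search_solvable search_start start_sound _ _.
  move=> g; rewrite mem_filter => /andP[_ gG]; split.
    exact: products_symmetry generators_automorphism g gG.
  have [pg _] := products_symmetry generators_automorphism gG.
  have szg : size g = 30 by rewrite (perm_size pg).
  apply/eqP; apply: (@eq_from_nth _ 0); rewrite !size_map ?size_nseq // => k lt_k.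
  have lt_g : nth 0 g k < 30.
    by move: (mem_nth 0 lt_k); rewrite (perm_mem pg) mem_iota.
  by rewrite (nth_map 0) // !map_nseq !nth_nseq lt_g -szg lt_k.
by move=> v lt_v; rewrite /lower nth_nseq lt_v; split=> //; left.
Qed.

(** * The bound for corner solutions *)

(** Passes from counts per variety to actual distinct cubes, chosen greedily. *)
Lemma distinct_choice (I : finType) (f : I -> nat) (ws : seq nat) :
    {in ws, forall w, count_mem w ws <= #|[set i | f i == w]|} ->
  exists2 s : seq I, uniq s & map f s = ws.
Proof.
elim: ws => [|w ws IHws] cnt; first by exists [::].
have [u uw|s us fs] := IHws.
  by apply: leq_trans (cnt u _); rewrite ?inE ?uw ?orbT // leq_addl.
have /existsP[i /andP[/eqP fi si]] : [exists i, (f i == w) && (i \notin s)].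
  apply: contraT; rewrite negb_exists => /forallP out.
  suff: #|[set i | f i == w]| <= count_mem w ws.
    by rewrite leqNgt; apply: contraNT => _; apply: leq_trans (cnt w (mem_head _ _));
       rewrite /= eqxx.
  rewrite -fs count_map -size_filter -(card_uniqP (filter_uniq _ us)).
  apply/subset_leq_card/subsetP=> i; rewrite inE mem_filter => fi.
  by move: (out i); rewrite /= fi negbK.
by exists (i :: s); rewrite /= ?si // fi fs.
Qed.

Lemma corner_solution_exists (I : finType) (cubes : I -> colored_cube) :
    24 <= #|I| ->
  exists A : {set I}, #|A| = 8 /\ corner_solution cubes A.
Proof.
move=> le24; pose f i := variety (paint_code (cubes i)).
have lt_f i : f i < 30 := allP variety_total _ (cube_paint_code (cubes i)).
pose m w := #|[set i | f i == w]|.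
have [|v lt_v [L [incL subL cntL]]] := @solvable24 m.
  rewrite (leq_trans le24) // -sum1_card big_mkord.
  rewrite (partition_big (fun i => Ordinal (lt_f i)) predT) //=.
  apply: leq_sum => w _; rewrite sum1_card; apply/subset_leq_card/subsetP=> i.
  by rewrite inE => /eqP <-.
have [w|s us fs] := @distinct_choice I f (unzip1 L).
  by case/mapP=> x /(allP incL)/andP[lt_x _] ->; apply: cntL.
have /card_gt0P[i0 _] : 0 < #|I| by apply: leq_trans le24.
have szs : size s = size L by rewrite -(size_map f) fs size_map.
pose slot p := nth [::] (nth [::] slots v) (index (corner_code p) corners).
have lt_p p : index (corner_code p) corners < 8.
  by rewrite -[8]/(size corners) index_mem corner_code_mem.
have slotL p : slot p \in unzip2 L by apply: subL; rewrite mem_nth ?size_slots.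
(* Position [p] gets the cube of the first pair in [L] whose corner is the one that [v] has at
   [p]. *)
pose place p := nth i0 s (index (slot p) (unzip2 L)).
have lt_i p : index (slot p) (unzip2 L) < size L.
  by rewrite -(size_map snd) index_mem.
(* [s] has no repetition and the eight corners of [v] differ, so a cube determines its position. *)
have place_inj : injective place.
  move=> p p' /eqP; rewrite nth_uniq ?szs // => /eqP.
  move/(congr1 (nth [::] (unzip2 L))); rewrite !nth_index // => /eqP.
  rewrite nth_uniq ?size_slots ?slots_uniq // => /eqP.
  move/(congr1 (nth [::] corners)); rewrite !nth_index ?corner_code_mem //.
  exact: corner_code_inj.
have rep_v : nth [::] varieties v \in permutations (iota 0 6).
  by apply: (allP varieties_perm); apply: mem_nth.
have fit p : exists r, forall x, on_outer_face p (rotate r x) ->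
    cubes (place p) x = decode (nth [::] varieties v) (rotate r x).
  apply/fitsP; rewrite decodeK // -(nth_index [::] (corner_code_mem p)).
  apply: cube_fits => //; rewrite -/(f _) -/(slot p).
  rewrite -(nth_map i0 0) ?szs // fs.
  rewrite (nth_map (0, [::])) // -[X in _ \in X](nth_index [::] (slotL p)).
  rewrite [X in _ \in X](nth_map (0, [::])) //.
  by case/andP: (allP incL _ (mem_nth (0, [::]) (lt_i p))).
have [turn fit_turn] := fin_all_exists fit.
exists (place @: [set: position 2]); split.
  by rewrite card_imset // cardsT card_ffun !card_ord.
exists place, turn, (decode (nth [::] varieties v)); split=> //.
- by move=> p p' _ _; apply: place_inj.
- exact: decode_inj.
by move=> p x _; apply: fit_turn.
Qed.

(** * Lower bound: 23 cubes without a corner solution *)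

Lemma frame2 : frame 2 = [set: position 2].
Proof.
apply/setP=> p; rewrite !inE (_ : [set i | _] = setT) ?cardsT ?card_ord //.
apply/setP=> i; rewrite !inE /on_outer_face /=.
by case: (p i) => -[|[|]].
Qed.

(* Every corner belongs to exactly one of these five varieties, so that the
   eight corners of a sixth one need two cubes of each of four of them. *)
Definition scarce : seq (seq nat * nat) :=
  [:: ([:: 0; 1; 2; 3; 4; 5], 7); ([:: 0; 2; 1; 4; 3; 5], 7);
      ([:: 0; 3; 1; 5; 2; 4], 7); ([:: 0; 4; 1; 3; 5; 2], 1);
      ([:: 0; 5; 1; 2; 4; 3], 1)].

Definition owners (o P : seq nat) : seq (seq nat) :=
  [seq q <- unzip1 scarce | fits q o P].

(** If [o] is of one of the five varieties, all eight corners need that variety, which has at most 7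
    cubes. Otherwise four of the five are needed twice, and one of these four is present only
    once. *)
Lemma scarce_deficient :
  all (fun o => let s := [seq owners o P | P <- corners] in
         has (fun x => x.2 < count_mem [:: x.1] s) scarce)
      (permutations (iota 0 6)).
Proof. by vm_compute. Qed.

Definition scarce_paints : seq (seq nat) := flatten [seq nseq x.2 x.1 | x <- scarce].

(** The default [iota 0 6] is itself a painting, so [scarce_cube] is defined at every index. *)
Lemma scarce_paint i : nth (iota 0 6) scarce_paints i \in permutations (iota 0 6).
Proof.
have [lt_i | le_i] := ltnP i (size scarce_paints); last first.
  by rewrite nth_default // mem_permutations.
by apply: allP (mem_nth _ lt_i); vm_compute.
Qed.

Definition scarce_cube (i : nat) : colored_cube :=
  ColoredCube (decode_surj (scarce_paint i)).

Lemma frame_not_buildable M : M < 24 -> ~ frame_always_buildable 2 M.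
Proof.
move=> ltM /(_ (fun i => scarce_cube i))[A]; rewrite frame2.
case=> place [turn [outer [place_inj _ outer_inj fit]]].
pose o := paint_code outer; pose q (i : 'I_M) := nth (iota 0 6) scarce_paints i.
have qE (i : 'I_M) : paint_code (scarce_cube i) = q i by apply: decodeK (scarce_paint i).
have lt_i (i : 'I_M) : i < size scarce_paints by apply: leq_trans (ltn_ord i) _.
have fits_q p : fits (q (place p)) o (corner_code p).
  by rewrite -qE; apply/fitsP; exists (turn p) => x; apply: fit; rewrite inE.
have own p : q (place p) \in owners o (corner_code p).
  rewrite mem_filter fits_q; have := mem_nth (iota 0 6) (lt_i (place p)).
  by case/flatten_mapP=> x xS /nseqP[def_q _]; rewrite /q def_q map_f.
have /hasP[[y k] yS /= ltk] := allP scarce_deficient _ (inj_paint_code outer_inj).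
(* The corners in [S] can only be filled by cubes painted [y]; as [place] is injective, there are at
   least as many such cubes as corners in [S], which is too many. *)
pose S := [set p | owners o (corner_code p) == [:: y]].
have cardS : count_mem [:: y] [seq owners o P | P <- corners] <= #|S|.
  rewrite count_map -size_filter cardE -(size_map corner_code).
  apply: uniq_leq_size; first exact: filter_uniq.
  move=> P; rewrite mem_filter => /andP[/= oP /cornersP[p defP]].
  by rewrite defP map_f // mem_enum inE -defP.
have sub : place @: S \subset [set i | q i == y].
  apply/subsetP=> _ /imsetP[p pS ->]; move: pS; rewrite /S in_set => /eqP own_p.
  by move: (own p); rewrite own_p mem_seq1 in_set.
have := subset_leq_card sub; rewrite card_imset; last first.
  by move=> p p'; apply: place_inj; rewrite inE.
apply/negP; rewrite -ltnNge; apply: leq_trans cardS; apply: leq_trans ltk; rewrite ltnS.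
have <- : count_mem y scarce_paints = k.
  by move: yS; do 5![case/predU1P=> [[-> ->] //|]].
rewrite -[X in count_mem _ X](mkseq_nth (iota 0 6)) count_map.
rewrite -size_filter cardE -(size_map val); apply: uniq_leq_size.
  by rewrite (map_inj_uniq val_inj) enum_uniq.
move=> _ /mapP[i + ->]; rewrite mem_enum inE => qi.
rewrite mem_filter mem_iota add0n lt_i !andbT; exact: qi.
Qed.

Theorem theoremA :
  (forall cubes : 'I_24 -> colored_cube,
     exists A : {set 'I_24}, #|A| = 8 /\ corner_solution cubes A) /\
  is_fr 2 24.
Proof.
have sol cubes := @corner_solution_exists 'I_24 cubes.
rewrite card_ord in sol; split=> [cubes|]; first exact: sol.
split=> [cubes|M bM]; last first.
  by rewrite leqNgt; apply/negP=> ltM; apply: frame_not_buildable bM.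
by have [//|A [_ solA]] := sol cubes; exists A; rewrite frame2.
Qed.
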